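(* (1) On every turn-based game structure, $[\simeq_g]=[\simeq_{12}]$. (2) There exist a deterministic game structure $G$ and states $s,t$ of $G$ with $[s\simeq_g t]>[s\simeq_{12} t]$. (3) There exist a deterministic game structure $G$ and states $s,t$ of $G$ with $[s\simeq_g t]<[s\simeq_{12} t]$.
   Context: A game structure $G=(S,[\cdot],\mathit{Moves},\Gamma_1,\Gamma_2,\delta)$: finite state set $S$; finite set $V$ of observation variables, each $v$ interpreted as $[v]:S\to[0,1]$; finite move set; $\Gamma_1,\Gamma_2:S\to2^{\mathit{Moves}}\setminus\{\emptyset\}$; $\delta:S\times\mathit{Moves}\times\mathit{Moves}\to\mathrm{Distr}(S)$. $G$ is deterministic if every $\delta(s,a_1,a_2)$ is a point mass. $G$ is turn-based if $S=S_1\uplus S_2$ with $|\Gamma_2(s)|=1$ on $S_1$, $|\Gamma_1(s)|=1$ on $S_2$, and some $\mathit{turn}\in V$ has $[\mathit{turn}](s)=1$ iff $s\in S_1$ and $=0$ iff $s\in S_2$. $\bar i=3-i$. Mixed moves $\mathcal{D}_i(s)=\mathrm{Distr}(\Gamma_i(s))$; $\delta(s,x_1,x_2)(u)=\sum_{a_1,a_2}\delta(s,a_1,a_2)(u)x_1(a_1)x_2(a_2)$. Valuations $k:S\to[0,1]$; $\mathrm{E}^{x_1,x_2}_s(k)=\sum_u\delta(s,x_1,x_2)(u)k(u)$; $\mathrm{Pre}_i(k)(s)=\sup_{x_i\in\mathcal{D}_i(s)}\inf_{x_{\bar i}\in\mathcal{D}_{\bar i}(s)}\mathrm{E}^{x_1,x_2}_s(k)$.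 Directed metrics $d:S\times S\to\mathbb{R}_{\ge0}$ ($d(s,s)=0$, triangle inequality), ordered pointwise; $\breve d(s,t)=d(t,s)$; $\sqcup=\max$; $C(d)=\{k:k(s)-k(t)\le d(s,t)\ \forall s,t\}$; $[s\equiv t]=\max_v|[v](s)-[v](t)|$. $H_{\preceq_i}(d)(s,t)=[s\equiv t]\sqcup\sup_{k\in C(d)}(\mathrm{Pre}_i(k)(s)-\mathrm{Pre}_i(k)(t))$; $[\simeq_i]$ is the least fixpoint of $d\mapsto H_{\preceq_i}(d)\sqcup\breve{H_{\preceq_i}(d)}$; $[\simeq_1]=[\simeq_2]=:[\simeq_g]$ (a priori game bisimulation metric). Cooperative metrics: $H_{\preceq_{12}}(d)(s,t)=[s\equiv t]\sqcup\sup_{k\in C(d)}\sup_{x_1\in\mathcal{D}_1(s)}\sup_{x_2\in\mathcal{D}_2(s)}\inf_{y_2\in\mathcal{D}_2(t)}\inf_{y_1\in\mathcal{D}_1(t)}(\mathrm{E}^{x_1,x_2}_s(k)-\mathrm{E}^{y_1,y_2}_t(k))$, $H_{\simeq_{12}}(d)(s,t)=H_{\preceq_{12}}(d)(s,t)\sqcup H_{\preceq_{12}}(d)(t,s)$, and $[\simeq_{12}]$ is the least fixpoint of $H_{\simeq_{12}}$. $[s\simeq t]$ denotes $[\simeq](s,t)$. *)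

(* Defs.v *)
From HB Require Import structures.
From mathcomp Require Import all_boot all_order all_algebra.
From mathcomp Require Import mathcomp_extra boolp classical_sets functions reals.
From mathcomp Require Import ring lra.

Set Implicit Arguments.
Unset Strict Implicit.
Unset Printing Implicit Defensive.

Import Order.TTheory GRing.Theory Num.Theory.
Local Open Scope classical_set_scope.
Local Open Scope ring_scope.

Definition is_distr (R : realType) (T : finType) (p : T -> R) : Prop :=
  (forall x, 0 <= p x) /\ \sum_x p x = 1.

Definition point_mass (R : realType) (T : finType) (u : T) : T -> R :=
  fun v => (v == u)%:R.

Variant player : Set := P1 | P2.

Definition opponent (i : player) : player :=
  match i with P1 => P2 | P2 => P1 end.

Record game_structure (R : realType) : Type := GameStructure {
  state : finType;
  obs : finType;
  move : finType;
  interp : obs -> state -> R;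
  interp_bounds : forall v s, 0 <= interp v s <= 1;
  avail : player -> state -> {set move};
  avail_neq0 : forall i s, avail i s != finset.set0;
  delta : state -> move -> move -> state -> R;
  delta_distr : forall s a1 a2, is_distr (delta s a1 a2)
}.

Section Metrics.
Context {R : realType} {S : finType}.
Implicit Types d : S -> S -> R.

Definition directed_metric d : Prop :=
  [/\ forall s t, 0 <= d s t,
      forall s, d s s = 0 &
      forall s t u, d s u <= d s t + d t u].

Definition metric_le d d' : Prop := forall s t, d s t <= d' s t.

Definition metric_max d d' : S -> S -> R := fun s t => Num.max (d s t) (d' s t).

Definition metric_rev d : S -> S -> R := fun s t => d t s.

Definition valuation : set (S -> R) := [set k | forall s, 0 <= k s <= 1].

Definition lipschitz d : set (S -> R) :=
  [set k | valuation k /\ forall s t, k s - k t <= d s t].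

Definition is_least_fixpoint (H : (S -> S -> R) -> S -> S -> R) d : Prop :=
  [/\ directed_metric d, H d = d &
      forall d', directed_metric d' -> H d' = d' -> metric_le d d'].

(* The default value is never used: the operators below do have a least
   fixpoint among directed metrics, see bisim_metricP and coop_metricP. *)
Definition least_fixpoint (H : (S -> S -> R) -> S -> S -> R) : S -> S -> R :=
  xget (fun _ _ => 0) [set d | is_least_fixpoint H d].

End Metrics.

Section Games.
Context {R : realType} (G : game_structure R).
Implicit Types (s t u : state G) (k : state G -> R) (d : state G -> state G -> R).

Definition deterministic : Prop :=
  forall s a1 a2, exists u, delta s a1 a2 = point_mass R u.

Definition turn_based : Prop :=
  exists S1 S2 : {set state G},
    [/\ S1 :|: S2 = [set: state G]%SET, S1 :&: S2 = finset.set0,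
        forall s, s \in S1 -> #|avail P2 s| = 1%N,
        forall s, s \in S2 -> #|avail P1 s| = 1%N &
        exists turn : obs G, forall s,
          (interp turn s = 1 <-> s \in S1) /\ (interp turn s = 0 <-> s \in S2)].

(* A distribution on the available moves is extended by 0 to all moves. *)
Definition mixed (i : player) s : set (move G -> R) :=
  [set x | is_distr x /\ forall a, a \notin avail i s -> x a = 0].

Definition mixed_delta s (x1 x2 : move G -> R) u : R :=
  \sum_a1 \sum_a2 delta s a1 a2 u * x1 a1 * x2 a2.

Definition expect s (x1 x2 : move G -> R) k : R :=
  \sum_u mixed_delta s x1 x2 u * k u.

(* The expectation when player i plays x and her opponent plays y. *)
Definition expect_for (i : player) s (x y : move G -> R) k : R :=
  match i with P1 => expect s x y k | P2 => expect s y x k end.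

Definition Pre (i : player) k s : R :=
  sup [set inf [set expect_for i s x y k | y in mixed (opponent i) s]
      | x in mixed i s].

Definition obs_dist s t : R :=
  \big[Num.max/0]_(v : obs G) `|interp v s - interp v t|.

Definition H_sim (i : player) d : state G -> state G -> R := fun s t =>
  Num.max (obs_dist s t) (sup [set Pre i k s - Pre i k t | k in lipschitz d]).

Definition H_bisim (i : player) d : state G -> state G -> R :=
  metric_max (H_sim i d) (metric_rev (H_sim i d)).

(* By determinacy of matrix games the two players induce the same metric, the
   game bisimulation metric. *)
Definition bisim_metric (i : player) : state G -> state G -> R :=
  least_fixpoint (H_bisim i).

Definition H_coop_sim d : state G -> state G -> R := fun s t =>
  Num.max (obs_dist s t)
    (sup [set sup [set sup [set
       inf [set inf [set expect s x1 x2 k - expect t y1 y2 k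
       | y1 in mixed P1 t] | y2 in mixed P2 t]
       | x2 in mixed P2 s] | x1 in mixed P1 s] | k in lipschitz d]).

Definition H_coop d : state G -> state G -> R :=
  metric_max (H_coop_sim d) (metric_rev (H_coop_sim d)).

Definition coop_metric : state G -> state G -> R := least_fixpoint H_coop.

End Games.

Arguments bisim_metric {R} G i.
Arguments coop_metric {R} G.

Section LeastFixpointExistence.
Context {R : realType}.

Lemma supE_le (T : Type) (A : set T) (f : T -> R) (b : R) :
  A !=set0 -> (forall x, A x -> f x <= b) -> sup [set f x | x in A] <= b.
Proof.
move=> [a Aa] fb; apply: ge_sup; first by exists (f a), a.
by move=> _ [x Ax <-]; exact: fb.
Qed.

Lemma le_supE (T : Type) (A : set T) (f : T -> R) (b : R) x :
  (forall x, A x -> f x <= b) -> A x -> f x <= sup [set f x | x in A].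
Proof.
move=> fb Ax; apply: ub_le_sup; last by exists x.
by exists b => _ [y Ay <-]; exact: fb.
Qed.

Lemma infE_ge (T : Type) (A : set T) (f : T -> R) (b : R) :
  A !=set0 -> (forall x, A x -> b <= f x) -> b <= inf [set f x | x in A].
Proof.
move=> [a Aa] fb; apply: lb_le_inf; first by exists (f a), a.
by move=> _ [x Ax <-]; exact: fb.
Qed.

Lemma ge_infE (T : Type) (A : set T) (f : T -> R) (b : R) x :
  (forall x, A x -> b <= f x) -> A x -> inf [set f x | x in A] <= f x.
Proof.
move=> fb Ax; apply: ge_inf; last by exists x.
by exists b => _ [y Ay <-]; exact: fb.
Qed.

Lemma sup_addE (T : Type) (A : set T) (f : T -> R) (b c : R) :
  A !=set0 -> (forall x, A x -> f x <= b) ->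
  sup [set f x + c | x in A] = sup [set f x | x in A] + c.
Proof.
move=> A0 fb; apply/le_anti/andP; split.
  by apply: supE_le => // x Ax; rewrite lerD2r; exact: (le_supE fb).
rewrite -lerBrDr; apply: supE_le => // x Ax; rewrite lerBrDr.
by apply: (@le_supE _ _ (fun x => f x + c) (b + c)) => // y Ay; rewrite lerD2r; exact: fb.
Qed.

Lemma inf_subE (T : Type) (A : set T) (f : T -> R) (b c : R) :
  A !=set0 -> (forall x, A x -> f x <= b) ->
  inf [set c - f x | x in A] = c - sup [set f x | x in A].
Proof.
move=> A0 fb; apply/le_anti/andP; split.
  rewrite lerBrDr addrC -lerBrDr; apply: supE_le => // x Ax.
  rewrite lerBrDr addrC -lerBrDr.
  apply: (@ge_infE _ _ (fun x => c - f x) (c - b)) => // y Ay.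
  by rewrite lerD2l lerN2; exact: fb.
apply: infE_ge => // x Ax; rewrite lerD2l lerN2; exact: (le_supE fb).
Qed.

Lemma sup_in01 (T : Type) (A : set T) (f : T -> R) :
  A !=set0 -> (forall x, A x -> 0 <= f x <= 1) -> 0 <= sup [set f x | x in A] <= 1.
Proof.
move=> A0 f01; apply/andP; split; last by apply: supE_le => // x /f01 /andP[].
have [a Aa] := A0; apply: (@le_trans _ _ (f a)); first by case/andP: (f01 _ Aa).
by apply: (@le_supE _ _ _ 1) => // x /f01 /andP[].
Qed.

Lemma inf_in01 (T : Type) (A : set T) (f : T -> R) :
  A !=set0 -> (forall x, A x -> 0 <= f x <= 1) -> 0 <= inf [set f x | x in A] <= 1.
Proof.
move=> A0 f01; apply/andP; split; first by apply: infE_ge => // x /f01 /andP[].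
have [a Aa] := A0; apply: (@le_trans _ _ (f a)); last by case/andP: (f01 _ Aa).
by apply: (@ge_infE _ _ _ 0) => // x /f01 /andP[].
Qed.

(* Directed metrics are closed under pointwise joins but not meets, so the
   greatest lower bound of the pre-fixpoints is built as a join. *)
Lemma least_fixpointP (S : finType) (H : (S -> S -> R) -> S -> S -> R) :
  (forall d, directed_metric d -> directed_metric (H d)) ->
  (forall d s t, directed_metric d -> H d s t <= 1) ->
  (forall d d', directed_metric d -> directed_metric d' ->
     metric_le d d' -> metric_le (H d) (H d')) ->
  is_least_fixpoint H (least_fixpoint H).
Proof.
move=> Hm H1 Hmono; rewrite /least_fixpoint; apply: xgetPex.
pose pre := [set p | directed_metric p /\ metric_le (H p) p].
pose L := [set d | directed_metric d /\ forall p, pre p -> metric_le d p].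
pose top := fun s t : S => (s != t)%:R : R.
have topm : directed_metric top.
  split=> [s t|s|s t u]; rewrite /top; first exact: ler0n.
    by rewrite eqxx.
  have [<-|st] := eqVneq s t; first by rewrite add0r.
  by case: (s == u); case: (t == u) => /=; lra.
have pretop : pre top.
  split=> // s t; rewrite /top; have [<-|st] := eqVneq s t; last exact: H1.
  by have [_ -> _] := Hm _ topm.
have L0 : L !=set0.
  exists (fun _ _ => 0); split; first by split=> *; rewrite ?addr0.
  by move=> p [[p0 _ _] _] s t; exact: p0.
have Lub s t d : L d -> d s t <= top s t by move=> [_ /(_ _ pretop)].
pose m := fun s t => sup [set d s t | d in L].
have lem d : L d -> metric_le d m.
  by move=> Ld s t; apply: (@le_supE _ L (fun d => d s t) _ d (Lub s t)).
have mm : directed_metric m.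
  split=> [s t|s|s t u].
  - have [d Ld] := L0; apply: le_trans (lem _ Ld s t).
    by case: Ld => -[].
  - apply/le_anti/andP; split.
      by apply: supE_le => // d [[_ -> _]].
    have [d Ld] := L0; apply: le_trans (lem _ Ld s s).
    by case: Ld => -[].
  - apply: supE_le => // d Ld; case: (Ld) => -[_ _ tri] _.
    by apply: le_trans (tri s t u) _; apply: lerD; exact: lem.
have mp p : pre p -> metric_le m p.
  move=> Pp s t; apply: supE_le => // d [_ /(_ _ Pp)]; exact.
have LHm : L (H m).
  split; first exact: Hm.
  move=> p Pp s t; case: (Pp) => pm Hp; apply: le_trans (Hp s t).
  by apply: Hmono => //; exact: mp.
have Hmm : metric_le (H m) m by exact: lem.
have preHm : pre (H m) by split; [exact: Hm|apply: Hmono => //; exact: Hm].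
exists m; split=> //; last first.
  by move=> d' d'm Hd'; apply: mp; split=> // s t; rewrite Hd'.
apply/funext => s; apply/funext => t; apply/le_anti/andP; split; first exact: Hmm.
exact: mp.
Qed.

Context (G : game_structure R).
Implicit Types (s t u : state G) (k : state G -> R) (d : state G -> state G -> R).

Lemma mixed_neq0 i s : mixed (G := G) i s !=set0.
Proof.
have /set0Pn[a sa] := avail_neq0 (g := G) i s.
exists (point_mass R a); split; last first.
  move=> b; rewrite /point_mass; have [->|//] := eqVneq b a.
  by rewrite sa.
split=> [b|]; first exact: ler0n.
rewrite (bigD1 a) //= /point_mass eqxx big1 ?addr0 // => b /negbTE ->.
by [].
Qed.

Lemma lipschitz_neq0 d : directed_metric d -> lipschitz d !=set0.
Proof.
case=> d0 _ _; exists (fun _ => 0); split=> [s|s t].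
  by rewrite lexx ler01.
by rewrite subrr.
Qed.

Lemma mixed_delta_distr s x1 x2 :
  is_distr x1 -> is_distr x2 -> is_distr (mixed_delta (G := G) s x1 x2).
Proof.
move=> [x10 x11] [x20 x21]; split=> [u|].
  apply: sumr_ge0 => a _; apply: sumr_ge0 => b _.
  by rewrite !mulr_ge0 //; case: (delta_distr s a b).
rewrite /mixed_delta exchange_big /= -[RHS]x11; apply: eq_bigr => a _.
rewrite exchange_big /= -[RHS]mulr1 -x21 mulr_sumr; apply: eq_bigr => b _.
rewrite -!mulr_suml; have [_ ->] := delta_distr s a b.
by rewrite mul1r.
Qed.

Lemma expect_in01 s x1 x2 k : is_distr x1 -> is_distr x2 -> valuation k ->
  0 <= expect (G := G) s x1 x2 k <= 1.
Proof.
move=> dx1 dx2 k01; have [p0 p1] := mixed_delta_distr s dx1 dx2.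
apply/andP; split.
  by apply: sumr_ge0 => u _; rewrite mulr_ge0 //; case/andP: (k01 u).
rewrite -p1; apply: ler_sum => u _; rewrite ler_piMr //.
by case/andP: (k01 u).
Qed.

Lemma Pre_in01 i k s : valuation k -> 0 <= Pre (G := G) i k s <= 1.
Proof.
move=> k01; apply: sup_in01 => [|x [dx _]]; first exact: mixed_neq0.
apply: inf_in01 => [|y [dy _]]; first exact: mixed_neq0.
by case: i; apply: expect_in01.
Qed.

Definition coop_value k s : R :=
  sup [set sup [set expect (G := G) s x1 x2 k | x2 in mixed P2 s]
      | x1 in mixed P1 s].

Lemma coop_value_in01 k s : valuation k -> 0 <= coop_value k s <= 1.
Proof.
move=> k01; apply: sup_in01 => [|x [dx _]]; first exact: mixed_neq0.
apply: sup_in01 => [|y [dy _]]; first exact: mixed_neq0.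
exact: expect_in01.
Qed.

Lemma coop_valueC k s : valuation k ->
  coop_value k s = sup [set sup [set expect (G := G) s x1 x2 k | x1 in mixed P1 s]
      | x2 in mixed P2 s].
Proof.
move=> k01.
have e1 x1 x2 : mixed P1 s x1 -> mixed P2 s x2 -> expect (G := G) s x1 x2 k <= 1.
  by move=> [dx1 _] [dx2 _]; case/andP: (expect_in01 s dx1 dx2 k01).
have n1 := mixed_neq0 P1 s; have n2 := mixed_neq0 P2 s.
apply/le_anti/andP; split.
  apply: supE_le => // x1 X1; apply: supE_le => // x2 X2.
  apply: (@le_trans _ _ (sup [set expect s x1 x2 k | x1 in mixed P1 s])).
    by apply: (@le_supE _ _ (fun x1 => expect s x1 x2 k) 1) => // x X; exact: e1.
  apply: (@le_supE _ _ (fun x2 => sup [set expect s x1 x2 k | x1 in mixed P1 s]) 1) => // y Y.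
  by apply: supE_le => // x X; exact: e1.
apply: supE_le => // x2 X2; apply: supE_le => // x1 X1.
apply: (@le_trans _ _ (sup [set expect s x1 x2 k | x2 in mixed P2 s])).
  by apply: (@le_supE _ _ (fun x2 => expect s x1 x2 k) 1) => // x X; exact: e1.
apply: (@le_supE _ _ (fun x1 => sup [set expect s x1 x2 k | x2 in mixed P2 s]) 1) => // y Y.
by apply: supE_le => // x X; exact: e1.
Qed.

Lemma coop_valueB k s t : valuation k ->
  sup [set sup [set
       inf [set inf [set expect s x1 x2 k - expect t y1 y2 k
       | y1 in mixed P1 t] | y2 in mixed P2 t]
       | x2 in mixed P2 s] | x1 in mixed P1 s]
  = coop_value k s - coop_value k t.
Proof.
move=> k01.
have e1 r x1 x2 : mixed P1 r x1 -> mixed P2 r x2 -> expect (G := G) r x1 x2 k <= 1.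
  by move=> [dx1 _] [dx2 _]; case/andP: (expect_in01 r dx1 dx2 k01).
have n i r := mixed_neq0 i r.
have inner c : inf [set inf [set c - expect t y1 y2 k
       | y1 in mixed P1 t] | y2 in mixed P2 t] = c - coop_value k t.
  rewrite coop_valueC //.
  rewrite -(@inf_subE _ _ (fun y2 => sup [set expect t y1 y2 k | y1 in mixed P1 t]) 1) //; last first.
    by move=> y Y; apply: supE_le => // x X; exact: e1.
  congr inf; apply: eq_imagel => y2 Y2.
  by rewrite (@inf_subE _ _ (fun y1 => expect t y1 y2 k) 1) // => x X; exact: e1.
rewrite /coop_value.
rewrite -(@sup_addE _ _ (fun x1 => sup [set expect s x1 x2 k | x2 in mixed P2 s]) 1) //; last first.
  by move=> y Y; apply: supE_le => // x X; exact: e1.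
congr sup; apply: eq_imagel => x1 X1.
rewrite -(@sup_addE _ _ (fun x2 => expect s x1 x2 k) 1) //; last by move=> x X; exact: e1.
by congr sup; apply: eq_imagel => x2 X2; rewrite inner.
Qed.

Lemma H_coop_simE d s t : H_coop_sim d s t =
  Num.max (obs_dist s t)
    (sup [set coop_value k s - coop_value k t | k in lipschitz d]).
Proof.
congr (Num.max _ (sup _)); apply: eq_imagel => k [k01 _].
exact: coop_valueB.
Qed.

Lemma obs_dist_max s t b : 0 <= b ->
  (forall v, `|interp (g := G) v s - interp v t| <= b) -> obs_dist s t <= b.
Proof.
by move=> b0 vb; apply: (big_ind (fun x => x <= b)) => // x y xb yb; rewrite ge_max xb.
Qed.

Lemma le_obs_dist v s t : `|interp (g := G) v s - interp v t| <= obs_dist s t.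
Proof. by rewrite /obs_dist (bigD1 v) //= le_max lexx. Qed.

Lemma obs_dist_ge0 s t : 0 <= obs_dist (G := G) s t.
Proof. by apply: (big_ind (fun x : R => 0 <= x)) => // x y x0 y0; rewrite le_max x0. Qed.

(* Common shape of the operators, f k s being the value of k at s. *)
Section Operator.
Variable f : (state G -> R) -> state G -> R.
Hypothesis f01 : forall k s, valuation k -> 0 <= f k s <= 1.

Let H d s t := Num.max (obs_dist s t) (sup [set f k s - f k t | k in lipschitz d]).

Let fB1 d s t k : lipschitz d k -> f k s - f k t <= 1.
Proof.
by move=> [k01 _]; have /andP[? ?] := f01 s k01; have /andP[? ?] := f01 t k01; lra.
Qed.

Let Hm d : directed_metric d -> directed_metric (H d).
Proof.
move=> dm; have C0 := lipschitz_neq0 dm; split=> [s t|s|s t u].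
- by rewrite le_max obs_dist_ge0.
- apply/le_anti/andP; split; last by rewrite le_max obs_dist_ge0.
  rewrite ge_max; apply/andP; split.
    by apply: obs_dist_max => // v; rewrite subrr normr0.
  by apply: supE_le => // k _; rewrite subrr.
- rewrite ge_max; apply/andP; split.
    apply: (@le_trans _ _ (obs_dist s t + obs_dist t u)).
      apply: obs_dist_max; first by rewrite addr_ge0 ?obs_dist_ge0.
      move=> v; apply: le_trans (ler_distD (interp v t) _ _) _.
      by apply: lerD; exact: le_obs_dist.
    by apply: lerD; rewrite le_max lexx.
  apply: supE_le => // k kd.
  have -> : f k s - f k u = (f k s - f k t) + (f k t - f k u) by ring.
  apply: lerD; rewrite le_max; apply/orP; right.
    exact: (le_supE (f := fun k => f k s - f k t) (fB1 s t)).
  exact: (le_supE (f := fun k => f k t - f k u) (fB1 t u)).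
Qed.

Let H1 d s t : directed_metric d -> H d s t <= 1.
Proof.
move=> dm; rewrite ge_max; apply/andP; split.
  apply: obs_dist_max => // v.
  have /andP[? ?] := interp_bounds (g := G) v s.
  have /andP[? ?] := interp_bounds (g := G) v t.
  by rewrite ler_norml; lra.
by apply: supE_le => [|k]; [exact: lipschitz_neq0|exact: fB1].
Qed.

Let Hmono d d' : directed_metric d -> metric_le d d' -> metric_le (H d) (H d').
Proof.
move=> dm dd' s t; rewrite ge_max le_max lexx /= le_max; apply/orP; right.
apply: supE_le => [|k [k01 kd]]; first exact: lipschitz_neq0.
apply: (le_supE (f := fun k => f k s - f k t) (fB1 (d := d') s t)).
by split=> // r q; apply: le_trans (kd r q) (dd' r q).
Qed.

Lemma operator_lfp :
  let H' d := metric_max (H d) (metric_rev (H d)) in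
  is_least_fixpoint H' (least_fixpoint H').
Proof.
apply: least_fixpointP => [d /Hm[p0 p1 p2]|d s t dm|d d' dm _ dd' s t].
- split=> [s t|s|s t u]; rewrite /metric_max /metric_rev.
  + by rewrite le_max p0.
  + by rewrite p1 maxxx.
  + rewrite ge_max; apply/andP; split.
      by apply: le_trans (p2 s t u) _; apply: lerD; rewrite le_max lexx.
    apply: le_trans (p2 u t s) _; rewrite addrC.
    by apply: lerD; rewrite le_max lexx orbT.
- by rewrite ge_max; apply/andP; split; exact: H1.
- by rewrite ge_max; apply/andP; split; rewrite le_max Hmono ?orbT.
Qed.

End Operator.

Lemma bisim_metricP i : is_least_fixpoint (H_bisim i) (bisim_metric G i).
Proof. by apply: (operator_lfp (f := Pre i)) => k s; exact: Pre_in01. Qed.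

Lemma coop_metricP : is_least_fixpoint (@H_coop R G) (coop_metric G).
Proof.
rewrite /coop_metric.
have -> : @H_coop R G = fun d => metric_max
    (fun s t => Num.max (obs_dist s t)
       (sup [set coop_value k s - coop_value k t | k in lipschitz d]))
    (metric_rev (fun s t => Num.max (obs_dist s t)
       (sup [set coop_value k s - coop_value k t | k in lipschitz d]))).
  apply/funext => d; apply/funext => s; apply/funext => t.
  by rewrite /H_coop /metric_max /metric_rev !H_coop_simE.
exact: (operator_lfp coop_value_in01).
Qed.

End LeastFixpointExistence.

(* Main.v *)
Require Import Defs.
From HB Require Import structures.
From mathcomp Require Import all_boot all_order all_algebra.
From mathcomp Require Import mathcomp_extra boolp classical_sets functions reals.
From mathcomp Require Import ring lra.

Import Order.TTheory GRing.Theory Num.Theory.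
Local Open Scope ring_scope.

(** At a state where only one player has a choice, the game value of [k] is
    either the cooperative value of [k] or, dually, [1] minus the cooperative
    value of [1 - k].  Fixpoints of the bisimulation operators are symmetric, so
    [k |-> 1 - k] preserves their Lipschitz functions, and the dual case merely
    exchanges the two states compared; states of different players are at
    distance [1] because of the turn variable.  Hence the two operators have the
    same fixpoints on turn-based games.

    Both separating examples are one-shot games.  If [s] and [t] lead to the
    same two outcomes, chosen by player 1 in [s] and by player 2 in [t], they
    have the same cooperative values and different game values.  If [t] always
    leads to one outcome, and [s] leads to the other one only when both players
    agree to, they have the same game values and different cooperative values. *)

Section GameStructures.
Local Open Scope classical_set_scope.
Context {R : realType} {G : game_structure R}.
Implicit Types (s t : state G) (k : state G -> R) (d : state G -> state G -> R).
Implicit Types (i : player).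

(** * Observation distances, complements and mixed moves *)

Lemma obs_distC s t : obs_dist s t = obs_dist t s.
Proof. by apply: eq_bigr => v _; rewrite distrC. Qed.

Lemma obs_dist_le1 s t : obs_dist s t <= 1.
Proof.
apply: obs_dist_max => // v.
have := interp_bounds v s; have := interp_bounds v t.
by move=> /andP[? ?] /andP[? ?]; rewrite ler_norml; lra.
Qed.

Lemma valuation_compl k : valuation k -> valuation (fun s => 1 - k s).
Proof. by move=> k01 s; have /andP[? ?] := k01 s; apply/andP; split; lra. Qed.

Lemma lipschitz_compl d k : (forall s t, d s t = d t s) ->
  lipschitz d k -> lipschitz d (fun s => 1 - k s).
Proof.
move=> dC [k01 kd]; split=> [|s t]; first exact: valuation_compl.
by rewrite dC; have := kd t s; lra.
Qed.

(** Holds because the successor weights sum to 1. *)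
Lemma expect_compl s (x1 x2 : move G -> R) k : is_distr x1 -> is_distr x2 ->
  expect s x1 x2 k = 1 - expect s x1 x2 (fun u => 1 - k u).
Proof.
move=> dx1 dx2; have [_ p1] := mixed_delta_distr s dx1 dx2.
rewrite /expect -{1}p1 -sumrB; apply: eq_bigr => u _; ring.
Qed.

Lemma point_mass_mixed i s (a : move G) : a \in avail i s ->
  mixed i s (point_mass R a).
Proof.
move=> sa; split; last first.
  move=> b; rewrite /point_mass; have [->|//] := eqVneq b a.
  by rewrite sa.
split=> [b|]; first exact: ler0n.
by rewrite (bigD1 a) //= /point_mass eqxx big1 ?addr0 // => b /negbTE ->.
Qed.

(** Lets suprema and infima over the moves of a player without choice collapse to a single value. *)
Lemma mixed_card1 i s : #|avail i s| = 1%N ->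
  exists2 y, is_distr y & mixed i s = [set y].
Proof.
move=> /eqP/cards1P[a sa]; have ma : mixed i s (point_mass R a).
  by apply: point_mass_mixed; rewrite sa inE.
exists (point_mass R a); first by case: ma.
apply/seteqP; split=> [x [[x0 x1] xa]|_ -> //].
apply/funext => b; rewrite /point_mass; have [->|ba] := eqVneq b a.
  rewrite /= -[RHS]x1 (bigD1 a) //= big1 ?addr0 // => c ca.
  by rewrite xa // sa inE.
by rewrite xa // sa inE.
Qed.

(** * Game values at states where one player has no choice *)

Lemma Pre_opponent_card1 i k s : #|avail (opponent i) s| = 1%N ->
  Pre i k s = coop_value k s.
Proof.
move=> /mixed_card1[y _ my]; rewrite /Pre /coop_value my.
case: i my => /= my; rewrite my.
  by congr sup; apply: eq_imagel => x _; rewrite !image_set1 inf1 sup1.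
rewrite image_set1 sup1; congr sup; apply: eq_imagel => x _.
by rewrite image_set1 inf1.
Qed.

(** The supremum over the only mixed move disappears; complementing [k] turns the remaining infimum
    over the opponent's moves into 1 minus a supremum. *)
Lemma Pre_own_card1 i k s : #|avail i s| = 1%N -> valuation k ->
  Pre i k s = 1 - coop_value (fun u => 1 - k u) s.
Proof.
move=> /mixed_card1[y dy my] /valuation_compl k01; rewrite /Pre /coop_value my.
rewrite image_set1 sup1.
case: i my => /= my; rewrite my.
  rewrite image_set1 sup1.
  rewrite -(@inf_subE _ _ _ (fun x => expect s y x (fun u => 1 - k u)) 1).
  - by congr inf; apply: eq_imagel => x [dx _]; rewrite expect_compl.
  - exact: mixed_neq0.
  - by move=> x [dx _]; case/andP: (expect_in01 s dy dx k01).
rewrite -(@inf_subE _ _ _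
  (fun x => sup [set expect s x x2 (fun u => 1 - k u) | x2 in [set y]]) 1).
- by congr inf; apply: eq_imagel => x [dx _]; rewrite image_set1 sup1 expect_compl.
- exact: mixed_neq0.
- move=> x [dx _]; rewrite image_set1 sup1.
  by case/andP: (expect_in01 s dx dy k01).
Qed.

(** * The two operators on turn-based games *)

Lemma H_sim_le1 i d s t : directed_metric d -> H_sim i d s t <= 1.
Proof.
move=> dm; rewrite ge_max obs_dist_le1 /=.
apply: supE_le => [|k [k01 _]]; first exact: lipschitz_neq0.
have /andP[? ?] := Pre_in01 i s k01; have /andP[? ?] := Pre_in01 i t k01; lra.
Qed.

Lemma H_coop_sim_le1 d s t : directed_metric d -> H_coop_sim d s t <= 1.
Proof.
move=> dm; rewrite H_coop_simE ge_max obs_dist_le1 /=.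
apply: supE_le => [|k [k01 _]]; first exact: lipschitz_neq0.
have /andP[? ?] := coop_value_in01 s k01.
by have /andP[? ?] := coop_value_in01 t k01; lra.
Qed.

Lemma H_sim_opponent_card1 i d s t :
  #|avail (opponent i) s| = 1%N -> #|avail (opponent i) t| = 1%N ->
  H_sim i d s t = H_coop_sim d s t.
Proof.
move=> s1 t1; rewrite H_coop_simE; congr (Num.max _ (sup _)).
by apply: eq_imagel => k _; rewrite !Pre_opponent_card1.
Qed.

Lemma H_sim_own_card1 i d s t : (forall s t, d s t = d t s) ->
  #|avail i s| = 1%N -> #|avail i t| = 1%N ->
  H_sim i d s t = H_coop_sim d t s.
Proof.
move=> dC s1 t1; rewrite H_coop_simE obs_distC; congr (Num.max _ (sup _)).
apply/seteqP; split=> _ [k kd <-];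
  (exists (fun u => 1 - k u); first exact: lipschitz_compl).
  by rewrite !Pre_own_card1; [ring|case: kd..].
have [k01 _] := lipschitz_compl _ _ dC kd.
rewrite !Pre_own_card1 //.
(* Complementation is an involution, which gives the converse inclusion of the two sets of
   differences. *)
have -> : (fun u => 1 - (1 - k u)) = k by apply/funext => u; ring.
ring.
Qed.

Lemma H_bisim_turn_based i d : turn_based G -> directed_metric d ->
  (forall s t, d s t = d t s) -> H_bisim i d = H_coop d.
Proof.
move=> [S1 [S2 [S12 S120 a1 a2 [turn turnP]]]] dm dC.
have cardS s : if s \in S1 then #|avail P2 s| = 1%N else #|avail P1 s| = 1%N.
  case: ifPn => [/a1//|sS1]; apply: a2.
  have : s \in S1 :|: S2 by rewrite S12 inE.
  by rewrite inE (negbTE sS1).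
have obs1 s t : (s \in S1) != (t \in S1) -> obs_dist s t = 1.
  have turnS r : interp turn r = (r \in S1)%:R.
    case: (boolP (r \in S1)) => [rS1|rS1]; first by apply/(turnP r).1.
    apply/(turnP r).2; have : r \in S1 :|: S2 by rewrite S12 inE.
    by rewrite inE (negbTE rS1).
  move=> st; apply/le_anti; rewrite obs_dist_le1 /=.
  apply: le_trans (le_obs_dist turn s t); rewrite !turnS.
  by move: st; case: (s \in S1); case: (t \in S1) => //= _;
    rewrite ?subr0 ?sub0r ?normrN normr1.
have far s t : (s \in S1) != (t \in S1) -> H_bisim i d s t = H_coop d s t.
  move=> st; rewrite /H_bisim /H_coop /metric_max /metric_rev.
  (* Both operators dominate the observation distance and are at most 1, so they equal 1 as soon as
     it does. *)
  have sim1 s' t' : obs_dist s' t' = 1 -> H_sim i d s' t' = 1.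
    by move=> o1; apply/le_anti; rewrite H_sim_le1 //= le_max o1 lexx.
  have coop1 s' t' : obs_dist s' t' = 1 -> H_coop_sim d s' t' = 1.
    by move=> o1; apply/le_anti; rewrite H_coop_sim_le1 //= le_max o1 lexx.
  have o1 := obs1 _ _ st; have o2 : obs_dist t s = 1 by rewrite obs_distC.
  by rewrite !sim1 // !coop1.
apply/funext => s; apply/funext => t.
have [st|/far//] := eqVneq (s \in S1) (t \in S1).
rewrite /H_bisim /H_coop /metric_max /metric_rev.
(* Now [s] and [t] have the same owner. If it is [i], the one-sided operators agree directly;
   otherwise they agree with the states exchanged, which the symmetrizing maximum absorbs. *)
move: (cardS s) (cardS t); rewrite -st; case: ifP => _ cs ct; case: i {far}.
- by rewrite !H_sim_opponent_card1.
- by rewrite !H_sim_own_card1 // maxC.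
- by rewrite !H_sim_own_card1 // maxC.
- by rewrite !H_sim_opponent_card1.
Qed.

Lemma bisim_metric_sym i s t : bisim_metric G i s t = bisim_metric G i t s.
Proof.
have [_ fix_d _] := bisim_metricP G i.
by rewrite -fix_d /H_bisim /metric_max /metric_rev maxC.
Qed.

Lemma coop_metric_sym s t : coop_metric G s t = coop_metric G t s.
Proof.
have [_ fix_d _] := coop_metricP G.
by rewrite -fix_d /H_coop /metric_max /metric_rev maxC.
Qed.

(** Both least fixpoints are symmetric, so each is also a fixpoint of the other operator, and
    minimality gives the two inequalities. *)
Lemma bisim_metric_turn_based i : turn_based G ->
  bisim_metric G i = coop_metric G.
Proof.
move=> tb; have [bm bfix bmin] := bisim_metricP G i.
have [cm cfix cmin] := coop_metricP G.
apply/funext => s; apply/funext => t; apply/le_anti/andP; split.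
  apply: bmin => //; rewrite H_bisim_turn_based //; exact: coop_metric_sym.
apply: cmin => //; rewrite -(H_bisim_turn_based i) //; exact: bisim_metric_sym.
Qed.

(** * Bounding the metrics through their fixpoint equations *)

Lemma le_bisim_metric i s t k : lipschitz (bisim_metric G i) k ->
  Pre i k s - Pre i k t <= bisim_metric G i s t.
Proof.
have [_ fix_d _] := bisim_metricP G i; move=> kd.
(* The fixpoint equation is unfolded once, at [s] and [t], on the right-hand side only. *)
rewrite -[leRHS](congr2 (fun f x => f x t) fix_d (erefl s)) le_max.
apply/orP; left; rewrite le_max; apply/orP; right.
apply: (@le_supE _ _ _ (fun k => Pre i k s - Pre i k t) 1) => // h [h01 _].
have /andP[? ?] := Pre_in01 i s h01; have /andP[? ?] := Pre_in01 i t h01; lra.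
Qed.

Lemma le_coop_metric s t k : lipschitz (coop_metric G) k ->
  coop_value k s - coop_value k t <= coop_metric G s t.
Proof.
have [_ fix_d _] := coop_metricP G; move=> kd.
rewrite -[leRHS](congr2 (fun f x => f x t) fix_d (erefl s)) le_max.
apply/orP; left; rewrite H_coop_simE le_max; apply/orP; right.
apply: (@le_supE _ _ _ (fun k => coop_value k s - coop_value k t) 1) => //.
move=> h [h01 _]; have /andP[? ?] := coop_value_in01 s h01.
by have /andP[? ?] := coop_value_in01 t h01; lra.
Qed.

(** One unfolding suffices: equal values make both suprema vanish, whatever the metric is at the
    successors. *)
Lemma bisim_metric_le0 i s t : obs_dist s t = 0 ->
  (forall k, valuation k -> Pre i k s = Pre i k t) -> bisim_metric G i s t <= 0.
Proof.
have [dm fix_d _] := bisim_metricP G i; move=> o0 eqk.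
rewrite -[leLHS](congr2 (fun f x => f x t) fix_d (erefl s)).
rewrite !ge_max [obs_dist t s]obs_distC o0 lexx /=; apply/andP; split.
  by apply: supE_le => [|k [k01 _]]; [exact: lipschitz_neq0|rewrite eqk ?subrr].
by apply: supE_le => [|k [k01 _]]; [exact: lipschitz_neq0|rewrite eqk ?subrr].
Qed.

Lemma coop_metric_le0 s t : obs_dist s t = 0 ->
  (forall k, valuation k -> coop_value k s = coop_value k t) ->
  coop_metric G s t <= 0.
Proof.
have [dm fix_d _] := coop_metricP G; move=> o0 eqk.
rewrite -[leLHS](congr2 (fun f x => f x t) fix_d (erefl s)).
rewrite /H_coop /metric_max /metric_rev !H_coop_simE.
rewrite !ge_max [obs_dist t s]obs_distC o0 lexx /=; apply/andP; split.
  by apply: supE_le => [|k [k01 _]]; [exact: lipschitz_neq0|rewrite eqk ?subrr].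
by apply: supE_le => [|k [k01 _]]; [exact: lipschitz_neq0|rewrite eqk ?subrr].
Qed.

Lemma interp_valuation (v : obs G) : valuation (interp v).
Proof. by move=> s; exact: interp_bounds. Qed.

(** Makes every observation a test function for [le_bisim_metric]. *)
Lemma interp_lipschitz_bisim i (v : obs G) :
  lipschitz (bisim_metric G i) (interp v).
Proof.
split=> [|s t]; first exact: interp_valuation.
have [_ fix_d _] := bisim_metricP G i; apply: le_trans (ler_norm _) _.
rewrite -[leRHS](congr2 (fun f x => f x t) fix_d (erefl s)).
by rewrite !le_max le_obs_dist.
Qed.

Lemma interp_lipschitz_coop (v : obs G) : lipschitz (coop_metric G) (interp v).
Proof.
split=> [|s t]; first exact: interp_valuation.
have [_ fix_d _] := coop_metricP G; apply: le_trans (ler_norm _) _.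
rewrite -[leRHS](congr2 (fun f x => f x t) fix_d (erefl s)).
by rewrite !le_max le_obs_dist.
Qed.

(** * Bounding values by particular moves *)

Lemma Pre_le i k s (y : move G -> R) (b : R) : valuation k ->
  mixed (opponent i) s y ->
  (forall x, mixed i s x -> expect_for i s x y k <= b) -> Pre i k s <= b.
Proof.
move=> k01 my xb; apply: supE_le => [|x mx]; first exact: mixed_neq0.
apply: le_trans (xb _ mx).
apply: (@ge_infE _ _ _ (fun y => expect_for i s x y k) 0) => // z [dz _].
by case: mx => dx _; case: (i); rewrite /expect_for;
  case/andP: (expect_in01 s dx dz k01); case/andP: (expect_in01 s dz dx k01).
Qed.

Lemma Pre_ge i k s (x : move G -> R) (b : R) : valuation k ->
  mixed i s x ->
  (forall y, mixed (opponent i) s y -> b <= expect_for i s x y k) ->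
  b <= Pre i k s.
Proof.
have e01 z y : valuation k -> mixed i s z -> mixed (opponent i) s y ->
    0 <= expect_for i s z y k <= 1.
  by move=> k01 [dz _] [dy _]; case: (i); exact: expect_in01.
move=> k01 mx yb.
apply: (@le_trans _ _
  (inf [set expect_for i s x y k | y in mixed (opponent i) s])).
  by apply: infE_ge => //; exact: mixed_neq0.
apply: (@le_supE _ _ _
  (fun x => inf [set expect_for i s x y k | y in mixed (opponent i) s]) 1) => //.
move=> z mz.
have /andP[] // := @inf_in01 _ _ _ (fun y => expect_for i s z y k)
  (mixed_neq0 (opponent i) s) (fun y => e01 z y k01 mz).
Qed.

Lemma coop_value_ge k s (x1 x2 : move G -> R) : valuation k ->
  mixed P1 s x1 -> mixed P2 s x2 -> expect s x1 x2 k <= coop_value k s.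
Proof.
have e1 y1 y2 : valuation k -> mixed P1 s y1 -> mixed P2 s y2 ->
    expect s y1 y2 k <= 1.
  by move=> k01 [d1 _] [d2 _]; case/andP: (expect_in01 s d1 d2 k01).
move=> k01 m1 m2.
apply: (@le_trans _ _ (sup [set expect s x1 y k | y in mixed P2 s])).
  by apply: (@le_supE _ _ _ (fun y => expect s x1 y k) 1) => // y; exact: e1.
apply: (@le_supE _ _ _
  (fun y1 => sup [set expect s y1 y k | y in mixed P2 s]) 1) => // y1 my1.
by apply: supE_le => [|y2]; [exact: mixed_neq0|exact: e1].
Qed.

(** The sum over successors is moved inside, where each point mass leaves a single term. *)
Lemma expect_deterministic (out : state G -> move G -> move G -> state G)
    s (x1 x2 : move G -> R) k :
  (forall s a1 a2, delta s a1 a2 = point_mass R (out s a1 a2)) ->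
  expect s x1 x2 k = \sum_a1 \sum_a2 k (out s a1 a2) * x1 a1 * x2 a2.
Proof.
move=> out_delta; rewrite /expect /mixed_delta.
under eq_bigr do rewrite mulr_suml.
rewrite exchange_big; apply: eq_bigr => a1 _ /=.
under eq_bigr do rewrite mulr_suml.
rewrite exchange_big; apply: eq_bigr => a2 _ /=.
rewrite (bigD1 (out s a1 a2)) //= out_delta /point_mass eqxx.
by rewrite big1 => [|u /negbTE ->]; [rewrite addr0 mul1r; ring|rewrite !mul0r].
Qed.

End GameStructures.

(** * One-shot deterministic games *)

Section OneShot.
Context (R : realType) (f : bool -> bool -> bool -> bool).

(* The initial states are the [inr c], and [inl b] is an absorbing outcome. *)
Let one_state : finType := (bool + bool)%type.

Definition one_shot_out (s : one_state) (a1 a2 : bool) : one_state :=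
  match s with inl b => inl b | inr c => inl (f c a1 a2) end.

(** The initial states all look alike, so only their outcomes can separate them; on outcomes this is
    the indicator of [true], the test function of both examples. *)
Definition one_shot_interp (_ : unit) (s : one_state) : R :=
  match s with inl b => b%:R | inr _ => 0 end.

Lemma one_shot_interp_bounds v s : 0 <= one_shot_interp v s <= 1.
Proof. by case: s => [[]|b] /=; rewrite ?lexx ?ler01. Qed.

Lemma one_shot_avail_neq0 (i : player) (s : one_state) :
  [set: bool]%SET != finset.set0.
Proof. by apply/set0Pn; exists true; rewrite inE. Qed.

Lemma one_shot_distr (s : one_state) (a1 a2 : bool) :
  is_distr (point_mass R (one_shot_out s a1 a2)).
Proof.
split=> [b|]; first exact: ler0n.
rewrite (bigD1 (one_shot_out s a1 a2)) //= /point_mass eqxx.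
by rewrite big1 ?addr0 // => b /negbTE ->.
Qed.

(** Both players have both moves everywhere, so their sets of mixed moves coincide; who has
    influence is encoded in [f]. *)
Definition one_shot : game_structure R :=
  @GameStructure R one_state unit bool one_shot_interp one_shot_interp_bounds
    (fun _ _ => [set: bool]%SET) one_shot_avail_neq0
    (fun s a1 a2 => point_mass R (one_shot_out s a1 a2)) one_shot_distr.

Definition init (c : bool) : state one_shot := inr c.

Lemma one_shot_deterministic : deterministic one_shot.
Proof. by move=> s a1 a2; exists (one_shot_out s a1 a2). Qed.

Lemma obs_dist_init c c' : obs_dist (init c) (init c') = 0.
Proof.
apply/le_anti; rewrite obs_dist_ge0 andbT.
by apply: obs_dist_max => // v; rewrite /= subrr normr0.
Qed.

Lemma one_shot_mixed_point i (s : state one_shot) (a : bool) :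
  mixed i s (point_mass R a).
Proof. by apply: point_mass_mixed; rewrite inE. Qed.

Lemma one_shot_mixed_sum i (s : state one_shot) (x : bool -> R) :
  mixed i s x -> x true + x false = 1.
Proof. by move=> [[_]]; rewrite big_bool. Qed.

Lemma expect_init c (x1 x2 : bool -> R) (k : state one_shot -> R) :
  expect (init c) x1 x2 k =
  k (inl (f c true true)) * x1 true * x2 true
  + k (inl (f c true false)) * x1 true * x2 false
  + (k (inl (f c false true)) * x1 false * x2 true
     + k (inl (f c false false)) * x1 false * x2 false).
Proof.
rewrite (@expect_deterministic _ one_shot one_shot_out) //.
by rewrite !big_bool.
Qed.

End OneShot.

(** * The two separating examples *)

Section Separation.
Context (R : realType).

Definition dictator (c a1 a2 : bool) := if c then a1 else a2.

Lemma coop_lt_bisim i :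
  coop_metric (one_shot R dictator) (init R dictator true) (init R dictator false)
  < bisim_metric (one_shot R dictator) i
      (init R dictator true) (init R dictator false).
Proof.
apply: (@le_lt_trans _ _ 0).
  apply: coop_metric_le0 => [|k k01]; first exact: obs_dist_init.
  (* Exchanging the suprema on the right lets [x] be the move of the player who decides on both
     sides. *)
  rewrite [RHS]coop_valueC // /coop_value; congr sup; apply: eq_imagel => x _.
  by congr sup; apply: eq_imagel => y _; rewrite !expect_init /=; ring.
have v01 := @interp_valuation _ (one_shot R dictator) tt.
apply: (@lt_le_trans _ _ 1) => //; case: i.
- apply: le_trans (le_bisim_metric _ (init R dictator true) (init R dictator false) _
    (@interp_lipschitz_bisim _ (one_shot R dictator) P1 tt)).
  (* Player 1 secures outcome [true] where she decides; where player 2 decides, his move [false]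
     forces observation 0. *)
  rewrite -[leLHS]subr0; apply: lerB.
    apply: (Pre_ge P1 _ _ _ _ v01 (one_shot_mixed_point _ _ P1 _ true)) => y.
    move=> /one_shot_mixed_sum y1; rewrite /expect_for expect_init /=.
    by rewrite /point_mass /=; lra.
  apply: (Pre_le P1 _ _ _ _ v01 (one_shot_mixed_point _ _ P2 _ false)) => x _.
  by rewrite /expect_for expect_init /= /point_mass /=; lra.
(* Player 2 decides in the second state, so the larger value is there. *)
- rewrite bisim_metric_sym.
  apply: le_trans (le_bisim_metric _ (init R dictator false) (init R dictator true) _
    (@interp_lipschitz_bisim _ (one_shot R dictator) P2 tt)).
  rewrite -[leLHS]subr0; apply: lerB.
    apply: (Pre_ge P2 _ _ _ _ v01 (one_shot_mixed_point _ _ P2 _ true)) => y.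
    move=> /one_shot_mixed_sum y1; rewrite /expect_for expect_init /=.
    by rewrite /point_mass /=; lra.
  apply: (Pre_le P2 _ _ _ _ v01 (one_shot_mixed_point _ _ P1 _ false)) => x _.
  by rewrite /expect_for expect_init /= /point_mass /=; lra.
Qed.

Definition conspiracy (c a1 a2 : bool) := [&& c, a1 & a2].

Lemma bisim_lt_coop i :
  bisim_metric (one_shot R conspiracy) i
    (init R conspiracy true) (init R conspiracy false)
  < coop_metric (one_shot R conspiracy)
      (init R conspiracy true) (init R conspiracy false).
Proof.
have v01 := @interp_valuation _ (one_shot R conspiracy) tt.
apply: (@le_lt_trans _ _ 0).
  (* Either player alone can force outcome [false]: the opponent's move [false] bounds the value
     above, the own move [false] below. *)
  have PreE c k : valuation k ->
      Pre i k (init R conspiracy c) = k (inl false).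
    move=> k01; apply/le_anti/andP; split.
      apply: (Pre_le i _ _ _ _ k01 (one_shot_mixed_point _ _ _ _ false)) => x.
      move=> /one_shot_mixed_sum x1.
      have {}x1 : x true = 1 - x false by lra.
      by case: (i); case: c; rewrite /expect_for expect_init /= /point_mass /= x1;
        lra.
    apply: (Pre_ge i _ _ _ _ k01 (one_shot_mixed_point _ _ _ _ false)) => y.
    move=> /one_shot_mixed_sum y1.
    have {}y1 : y true = 1 - y false by lra.
    by case: (i); case: c; rewrite /expect_for expect_init /= /point_mass /= y1;
      lra.
  apply: bisim_metric_le0 => [|k k01]; first exact: obs_dist_init.
  by rewrite !PreE.
apply: (@lt_le_trans _ _ 1) => //.
apply: le_trans (le_coop_metric (init R conspiracy true) (init R conspiracy false) _
  (@interp_lipschitz_coop _ (one_shot R conspiracy) tt)).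
(* Jointly playing [true] reaches observation 1 from the first state; the second one only leads to
   observation 0. *)
rewrite -[leLHS]subr0; apply: lerB.
  apply: le_trans (coop_value_ge _ (init R conspiracy true) _ _ v01
    (one_shot_mixed_point _ _ _ _ true) (one_shot_mixed_point _ _ _ _ true)).
  by rewrite expect_init /= /point_mass /=; lra.
apply: supE_le => [|x _]; first exact: mixed_neq0.
apply: supE_le => [|y _]; first exact: mixed_neq0.
by rewrite expect_init /=; lra.
Qed.

End Separation.

Theorem theorem3p14 (R : realType) :
  [/\ forall G : game_structure R, turn_based G ->
        forall i : player, bisim_metric G i = coop_metric G,
      exists G : game_structure R, deterministic G /\
        exists s t : state G, forall i : player,
          bisim_metric G i s t > coop_metric G s t &
      exists G : game_structure R, deterministic G /\
        exists s t : state G, forall i : player,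
          bisim_metric G i s t < coop_metric G s t].
Proof.
split.
- by move=> G tb i; exact: bisim_metric_turn_based.
- exists (one_shot R dictator); split; first exact: one_shot_deterministic.
  exists (init R dictator true), (init R dictator false) => i.
  exact: coop_lt_bisim.
- exists (one_shot R conspiracy); split; first exact: one_shot_deterministic.
  exists (init R conspiracy true), (init R conspiracy false) => i.
  exact: bisim_lt_coop.
Qed.
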